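(* Let $\mu$ be the natural Cantor probability measure on the middle-third Cantor set, $\gamma=\frac{\log2}{\log3}$ and $\beta=1-\gamma$. There is an absolute constant $A_0>0$ such that the following holds. Let $H\ge 3$ be an integer and let $K$ be the integer with $3^K\le H<3^{K+1}$. Then for every integer $M\ge0$ and all nonzero integers $u,v$, \[ \sum_{M<n,m\le M+H}|\widehat\mu(u2^n+v2^m)|\le A_0\, H^{1+\gamma}\, 3^{\beta\min(\nu_3(u),\nu_3(v),K)}, \] where the sum is over pairs of integers $(n,m)$.
   Context: The measure $\mu$ is the law of $\sum_{k\ge1}a_k3^{-k}$ with $a_k$ independent and uniformly distributed on $\{0,2\}$. Its Fourier transform at $q\in\mathbb Z$ is $\widehat\mu(q)=\int e^{2\pi i q x}\,d\mu(x)$. For a nonzero integer $q$, $\nu_3(q)=\max\{a\ge0: 3^a\mid q\}$. *)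

(* Defs.v *)
From HB Require Import structures.
From mathcomp Require Export all_boot all_order all_algebra.
From mathcomp Require Export all_classical all_reals all_analysis.
From mathcomp Require Export complex.
Export numFieldNormedType.Exports.
Set Implicit Arguments.
Unset Strict Implicit.
Unset Printing Implicit Defensive.
Import Order.TTheory GRing.Theory Num.Theory.

Local Open Scope classical_set_scope.
Local Open Scope ring_scope.

Definition mutually_independent (R : realType) (d : measure_display)
    (T : measurableType d) (P : probability T R) (a : nat -> {RV P >-> R}) :
    Prop :=
  forall (s : seq nat) (B : nat -> set R),
    uniq s -> (forall k, measurable (B k)) ->
    P (\bigcap_(k in [set` s]) (a k @^-1` B k)) =
    (\prod_(k <- s) P (a k @^-1` B k))%E.

(* The digit called a_k (k >= 1) in the expansion sum_(k >= 1) a_k 3^-k is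
   [a k.-1] here. The digits are in {0, 2} only almost surely, hence the
   almost sure convergence of the series to its sum X. *)
Definition cantor_measure (R : realType) (mu : probability R R) : Prop :=
  exists (d : measure_display) (T : measurableType d) (P : probability T R)
         (a : nat -> {RV P >-> R}) (X : {RV P >-> R}),
  [/\ mutually_independent a,
      forall k, P (a k @^-1` [set 0]) = (2^-1)%:E /\
                P (a k @^-1` [set 2]) = (2^-1)%:E,
      {ae P, forall t, (\sum_(k < n) a k t / 3 ^+ k.+1) @[n --> \oo] --> X t}
    & forall A : set R, measurable A -> mu A = distribution P X A].

Definition expi (R : realType) (t : R) : R[i] := Complex (cos t) (sin t).

Definition Cintegral (R : realType) (mu : probability R R)
    (f : R -> R[i]) : R[i] :=
  Complex (Rintegral mu setT (fun x => complex.Re (f x)))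
          (Rintegral mu setT (fun x => complex.Im (f x))).

Definition fourier (R : realType) (mu : probability R R) (q : int) : R[i] :=
  Cintegral mu (fun x => expi (2 * pi * q%:~R * x)).

Definition nu3 (q : int) : nat := logn 3 `|q|%N.

Definition cantor_dim (R : realType) : R := ln 2 / ln 3.

(* Main.v *)
(* The series sum_k a_k 3^-k almost surely has digits in {0, 2}, so
   |mu^(q)| = prod_(k >= 1) |cos (2 pi q / 3^k)|, and every partial product is
   an upper bound. If nu_3(u) <= nu_3(v), dropping the first nu_3(u) factors
   reduces to the case of u prime to 3. Since 4^(3^k) = 1 + 3^(k+1) t with
   t = 1 mod 3, shifting n by 2 * 3^k moves the last angle by a third of a turn
   while leaving the earlier factors unchanged; as
   |cos x| + |cos (x + 2 pi/3)| + |cos (x + 4 pi/3)| <= 2, the sum over n in a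
   block of length 2 * 3^k at most doubles when k increases by 1. A window of
   length H < 3^(K+1) is covered by 5 blocks of length 2 * 3^(K-1), whence the
   bound 5 H 2^K <= 5 H^(1+gamma), without any loss in nu_3. *)
From mathcomp Require Import zify ring lra.
From mathcomp Require Import measurable_realfun.
Require Import Defs.
Set Implicit Arguments.
Unset Strict Implicit.
Unset Printing Implicit Defensive.
Import Order.TTheory GRing.Theory Num.Theory.
Local Open Scope ring_scope.

(** * Cosines at angles separated by a third of a turn *)

Section Trig.
Variable R : realType.
Implicit Types x y : R.

Lemma cosD2piz x (z : int) : cos (x + 2 * pi * z%:~R) = cos x.
Proof.
have natcase y n : cos (y + 2 * pi * n%:R) = cos y.
  rewrite -[RHS](periodicn (@cosD2pi R) n y); congr cos.
  by ring.
case: z => n; first exact: natcase.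
rewrite NegzE mulrNz -[LHS](natcase _ n.+1).
by congr cos; ring.
Qed.

(** With [c] the cosine, the triple angle formula gives 4 c^3 - 3 c - 1 = (c - 1) (2 c + 1)^2 = 0,
    and [c < 0] excludes the root 1. *)
Lemma cos_2pi3 : cos (2 * pi / 3) = - (1 / 2) :> R.
Proof.
set a : R := 2 * pi / 3.
have pi0 := pi_gt0 R.
have c_lt0 : cos a < 0.
  have -> : a = pi / 6 + pi / 2 by rewrite /a; field.
  rewrite cosDpihalf oppr_lt0 sin_gt0_pi //; lra.
have : cos (a + a *+ 2) = 1.
  have -> : a + a *+ 2 = pi *+ 2 by rewrite /a; field.
  exact: cos2pi.
rewrite cosD cos_mulr2n sin_mulr2n.
have := sin2cos2 a; set c := cos a in c_lt0 *; set s := sin a => hs h.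
have : (c - 1) * (2 * c + 1) ^+ 2 = 0.
  transitivity (c * (c ^+ 2 *+ 2 - 1) - s * ((c * s) *+ 2) - 1
                + 2 * c * (s ^+ 2 - (1 - c ^+ 2))); first by ring.
  by rewrite h hs; ring.
move/eqP; rewrite mulf_eq0 sqrf_eq0 => /orP[] /eqP; lra.
Qed.

Lemma sum_cos3 x :
  cos x + cos (x + 2 * pi / 3) + cos (x + 2 * (2 * pi / 3)) = 0.
Proof.
have -> : 2 * (2 * pi / 3) = (2 * pi / 3) *+ 2 :> R by rewrite mulr_natl.
by rewrite 2!cosD cos_mulr2n sin_mulr2n cos_2pi3; field.
Qed.

(* Among three reals of sum 0, one has absolute value the sum of the other
   two. *)
Lemma sum_norm_cos3 x (e f : int) :
  `|cos x| + `|cos (x + 2 * pi / 3 * (1 + 3 * e)%:~R)|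
    + `|cos (x + 2 * pi / 3 * (2 + 3 * f)%:~R)| <= 2.
Proof.
have -> : cos (x + 2 * pi / 3 * (1 + 3 * e)%:~R) = cos (x + 2 * pi / 3).
  by rewrite -[RHS](cosD2piz _ e); congr cos; field.
have -> : cos (x + 2 * pi / 3 * (2 + 3 * f)%:~R)
        = cos (x + 2 * (2 * pi / 3)).
  by rewrite -[RHS](cosD2piz _ f); congr cos; field.
have := sum_cos3 x; have := cos_max x.
have := cos_max (x + 2 * pi / 3); have := cos_max (x + 2 * (2 * pi / 3)).
move: (cos _) (cos _) (cos _) => c b a.
by case: (ger0P a) => ?; case: (ger0P b) => ?; case: (ger0P c) => ?; lra.
Qed.

End Trig.

(** * Partial cosine products and their sums over blocks of exponents *)

Definition cosprod (R : realType) (N : nat) (q : int) : R :=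
  \prod_(0 <= k < N) `|cos (2 * pi * q%:~R / 3 ^+ k.+1)|.

Section Cosprod.
Variable R : realType.
Local Notation cosprod := (cosprod R).

Lemma cosprod_ge0 N q : 0 <= cosprod N q.
Proof. by apply: prodr_ge0 => k _; exact: normr_ge0. Qed.

Lemma cosprodS N q :
  cosprod N.+1 q = cosprod N q * `|cos (2 * pi * q%:~R / 3 ^+ N.+1)|.
Proof. by rewrite /cosprod big_nat_recr. Qed.

Lemma cosprod_le n N q : (n <= N)%N -> cosprod N q <= cosprod n q.
Proof.
move=> leqnN; rewrite -(subnK leqnN); elim: (N - n)%N => [|m IHm] //.
rewrite addSn cosprodS (le_trans _ IHm) // ler_piMr ?cosprod_ge0 //.
exact: cos_max.
Qed.

Lemma cosprodD N q z : cosprod N (q + 3 ^+ N * z) = cosprod N q.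
Proof.
apply: eq_big_nat => k /andP[_ ltkN].
rewrite -[in RHS](cosD2piz _ (3 ^+ (N - k.+1) * z)); congr `|cos _|.
have -> : (3 ^+ N : int) = 3 ^+ (N - k.+1) * 3 ^+ k.+1.
  by rewrite -exprD subnK.
rewrite intrD !intrM !rmorphXn /=.
have h : (3 : R) ^+ k.+1 != 0 by rewrite expf_neq0.
set p := 3 ^+ k.+1 in h *; by field.
Qed.

(** The first [a] factors are bounded by 1; in the other [N] the power of 3 cancels. *)
Lemma cosprod_mul3 N a q : cosprod (a + N) (3 ^+ a * q) <= cosprod N q.
Proof.
rewrite /cosprod addnC (@big_cat_nat _ _ _ a) ?leq_addl //=.
rewrite -[X in \prod_(X <= _ < N + a) _]add0n big_addn addnK.
rewrite -[leRHS]mul1r ler_pM //.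
- by apply: prodr_ge0 => k _; exact: normr_ge0.
- by apply: prodr_ge0 => k _; exact: normr_ge0.
- by apply: prodr_ile1 => k _; rewrite normr_ge0 cos_max.
rewrite le_eqVlt; apply/orP; left; apply/eqP.
apply: eq_bigr => k _; congr `|cos _|.
have h3 : (3 : R) != 0 by [].
rewrite intrM rmorphXn /= -addSn exprD.
have h1 : (3 : R) ^+ a != 0 by rewrite expf_neq0.
have h2 : (3 : R) ^+ k.+1 != 0 by rewrite expf_neq0.
set p := 3 ^+ k.+1 in h2 *; set r := 3 ^+ a in h1 *; by field; rewrite h1 h2.
Qed.

Lemma expr4_3 k : exists t : int, 4 ^+ (3 ^ k) = 1 + 3 ^+ k.+1 * (1 + 3 * t).
Proof.
elim: k => [|k [t IHk]]; first by exists 0.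
(* With y = 3^k and x = 1 + 3t, (1 + 3yx)^3 = 1 + 9y (x + 3yx^2 + 3y^2x^3), and the bracket is 1 + 3
   (t + yx^2 + y^2x^3). *)
exists (t + 3 ^+ k * (1 + 3 * t) ^+ 2 + (3 ^+ k) ^+ 2 * (1 + 3 * t) ^+ 3).
rewrite expnSr exprM IHk !exprS; set y := 3 ^+ k; ring.
Qed.

(** The three arguments agree modulo 3^(k+1), so they share their first [k.+1] factors. Their last
    angles differ by thirds of a turn, and [sum_norm_cos3] bounds the sum of the last factors by 2.
    The constant [c] carries the term in the other exponent, which stays fixed. *)
Lemma sum_cosprod_shift k (w c t r : int) : ~~ (3 %| w)%Z ->
  r = 1 + 3 ^+ k.+1 * (1 + 3 * t) ->
  cosprod k.+2 (w + c) + cosprod k.+2 (w * r + c)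
    + cosprod k.+2 (w * r ^+ 2 + c) <= 2 * cosprod k.+1 (w + c).
Proof.
move=> w3 rE.
pose d1 := w * (1 + 3 * t).
pose d2 := 2 * d1 + 3 * (3 ^+ k * (w * (1 + 3 * t) ^+ 2)).
have -> : w * r + c = w + c + 3 ^+ k.+1 * d1 by rewrite rE /d1; ring.
have -> : w * r ^+ 2 + c = w + c + 3 ^+ k.+1 * d2.
  by rewrite rE /d2 /d1 [3 ^+ k.+1]exprS; set y := 3 ^+ k; ring.
rewrite !(cosprodS k.+1) !cosprodD -!mulrDr mulrC ler_wpM2r ?cosprod_ge0 //.
have shift d : 2 * pi * (w + c + 3 ^+ k.+1 * d)%:~R / 3 ^+ k.+2
   = 2 * pi * (w + c)%:~R / 3 ^+ k.+2 + 2 * pi / 3 * d%:~R :> R.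
  rewrite intrD intrM rmorphXn /=.
  have h : (3 : R) ^+ k.+1 != 0 by rewrite expf_neq0.
  by rewrite [3 ^+ k.+2]exprS; set p := 3 ^+ k.+1 in h *; field.
rewrite !shift.
set x := 2 * pi * (w + c)%:~R / _.
(* Modulo 3, [d1] is [w] and [d2] is [2 * w], so (d1, d2) is (1, 2) or (2, 1); the second case swaps
   two summands. *)
have [v hv] : exists v, w = 1 + 3 * v \/ w = 2 + 3 * v.
  by exists (w %/ 3)%Z; lia.
pose e := v + t + 3 * v * t; pose f := v + 2 * t + 3 * v * t.
pose g := 3 ^+ k * (w * (1 + 3 * t) ^+ 2).
case: hv => hv.
  have -> : d1 = 1 + 3 * e by rewrite /d1 hv /e; ring.
  have -> : d2 = 2 + 3 * (2 * e + g) by rewrite /d2 /d1 -/g hv /e; ring.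
  exact: sum_norm_cos3.
have -> : d1 = 2 + 3 * f by rewrite /d1 hv /f; ring.
have -> : d2 = 1 + 3 * (1 + 2 * f + g) by rewrite /d2 /d1 -/g hv /f; ring.
by rewrite -addrA [X in _ + X]addrC addrA; exact: sum_norm_cos3.
Qed.

Lemma sum_cosprod_block k (u c : int) : ~~ (3 %| u)%Z ->
  \sum_(0 <= n < 2 * 3 ^ k) cosprod k.+1 (u * 2 ^+ n + c) <= 2 ^+ k.+1.
Proof.
elim: k => [|k IHk] u3.
  rewrite expr1 !big_nat_recr //= big_geq // add0r.
  have le1 q : cosprod 1 q <= 1.
    by rewrite (le_trans (cosprod_le q (leq0n 1))) // /cosprod big_geq.
  by rewrite -[leRHS]/(1 + 1) lerD.
have [t ht] := expr4_3 k.
rewrite expnSr mulnA; set L := (2 * 3 ^ k)%N in IHk *.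
have hL : 2 ^+ L = 1 + 3 ^+ k.+1 * (1 + 3 * t) :> int.
  by rewrite -ht /L exprM.
(* The block is folded modulo [L], grouping n, n + L and n + 2L: a shift by [L] multiplies 2^n by
   4^(3^k). *)
have -> F : \sum_(0 <= n < L * 3) F n
    = \sum_(0 <= n < L) (F n + F (n + L)%N + F (n + (L + L))%N) :> R.
  rewrite !big_split /= mulnC !mulSn addn0.
  rewrite (@big_cat_nat _ _ _ L) ?leq_addr //=.
  rewrite (@big_cat_nat _ _ _ (L + L) L) ?leq_addr ?leq_add2l ?leq_addr //=.
  have sh m : \sum_(m <= i < L + m) F i = \sum_(0 <= i < L) F (i + m)%N.
    by rewrite -{1}[m]add0n big_addn addnK.
  by rewrite !sh addrA.
rewrite exprS (le_trans _ (ler_wpM2l _ (IHk u3))) // mulr_sumr.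
apply: ler_sum => n _.
have -> : u * 2 ^+ (n + L) = u * 2 ^+ n * 2 ^+ L by rewrite exprD mulrA.
have -> : u * 2 ^+ (n + (L + L)) = u * 2 ^+ n * (2 ^+ L) ^+ 2.
  by rewrite !exprD -expr2 mulrA.
apply: sum_cosprod_shift hL.
apply: contra u3; rewrite Gauss_dvdzl //.
exact: coprimezXr.
Qed.

End Cosprod.

(** * Bounding the Fourier transform by partial cosine products *)

Section FourierBound.
Local Open Scope classical_set_scope.
Context (R : realType) (d : measure_display) (T : measurableType d).
Variables (P : probability T R) (a : nat -> {RV P >-> R}) (theta : R).
Hypothesis a_indep : mutually_independent a.
Hypothesis a_unif : forall k, P (a k @^-1` [set 0]) = (2^-1)%:E /\
                              P (a k @^-1` [set 2]) = (2^-1)%:E.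

(** A digit is 1 + 1 or 1 - 1 with equal probability, so the characteristic function of [S n] at
    [theta] is [C n] times the unit number of angle [theta * c n]; [c n] is the mean of [S n]. *)
Let S n t : R := \sum_(k < n) a k t / 3 ^+ k.+1.
Let C n : R := \prod_(0 <= k < n) cos (theta / 3 ^+ k.+1).
Let c n : R := \sum_(0 <= k < n) 3 ^- k.+1.

Let digits (s : seq nat) (b : nat -> R) : set T :=
  \bigcap_(k in [set` s]) (a k @^-1` [set b k]).

Lemma measurable_digit k (x : R) : measurable (a k @^-1` [set x]).
Proof. by rewrite -[X in measurable X]setTI; exact: measurable_funP. Qed.

Lemma measurable_digits s b : measurable (digits s b).
Proof. by apply: bigcap_measurableType => k _; exact: measurable_digit. Qed.

Lemma prob_digits s b : uniq s -> (forall k, b k = 0 \/ b k = 2) ->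
  P (digits s b) = (2^-1 ^+ size s)%:E.
Proof.
move=> us hb; rewrite (@a_indep s (fun k => [set b k])) //.
elim: s {us} => [|k s IHs]; first by rewrite big_nil.
rewrite big_cons IHs /= exprS EFinM; congr (_ * _)%E.
by have [h0 h2] := a_unif k; case: (hb k) => ->.
Qed.

Lemma digit_ae k : P (~` (a k @^-1` [set 0] `|` a k @^-1` [set 2])) = 0%E.
Proof.
have [h0 h2] := a_unif k.
have m0 := measurable_digit k 0; have m2 := measurable_digit k 2.
rewrite probability_setC; last exact: measurableU.
have dis : a k @^-1` [set 0] `&` a k @^-1` [set 2] = set0.
  by apply/seteqP; split => t //= -[-> /eqP]; rewrite eq_sym pnatr_eq0.
have sum1 (x y : \bar R) :
  x = (2^-1)%:E -> y = (2^-1)%:E -> (x + y = 1)%E.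
  by move=> -> ->; rewrite -EFinD; congr EFin; lra.
by rewrite (etrans (measureU P m0 m2 dis) (sum1 _ _ h0 h2)) subee.
Qed.

Lemma measurable_cosS n phi (D : set T) :
  measurable_fun D (fun t => cos (theta * S n t + phi)).
Proof.
apply: measurable_funTS.
apply: (measurableT_comp (f := @cos R)).
  by apply: continuous_measurable_fun; exact: continuous_cos.
apply: measurable_funD => //. apply: measurable_funM => //.
apply: measurable_sum => k; apply: measurable_funM => //.
Qed.

Lemma integrable_cos (D : set T) (f : T -> R) : measurable D ->
  measurable_fun D (fun t => cos (f t)) ->
  P.-integrable D (EFin \o (fun t => cos (f t))).
Proof.
move=> mD mf; apply: measurable_bounded_integrable => //.
  by rewrite (le_lt_trans (probability_le1 _ mD)) // ltry.
by exists 1; split => // x x1 t _ /=; rewrite (le_trans (cos_max _)) // ltW.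
Qed.

(* Conditioning on later digits makes the induction on n go through: one step
   splits according to the value of a_n, which joins the conditioned digits. *)
Lemma Rintegral_cosS n s b phi : uniq s -> (forall k, b k = 0 \/ b k = 2) ->
  (forall k, k \in s -> (n <= k)%N) ->
  \int[P]_(t in digits s b) cos (theta * S n t + phi)
  = 2^-1 ^+ size s * (C n * cos (theta * c n + phi)).
Proof.
elim: n s b phi => [|n IHn] s b phi us hb hs.
  rewrite /C /c big_geq // big_geq // mul1r.
  under eq_Rintegral do rewrite /S big_ord0.
  rewrite Rintegral_cst; last exact: measurable_digits.
  rewrite mulrC; congr (_ * _). exact: (congr1 fine (prob_digits us hb)).
pose A x := a n @^-1` [set x].
pose bx (x : R) k := if k == n then x else b k.
have ns : n \notin s by apply/negP => /hs; rewrite ltnn.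
have DA x : digits s b `&` A x = digits (n :: s) (bx x).
  rewrite /digits !bigcap_seq big_cons setIC /bx eqxx; congr (_ `&` _).
  apply: eq_big_seq => k /= ks; case: eqP => // kn.
  by rewrite -kn ks in ns.
(* Once the digit a_n is fixed to x, its contribution to the angle moves into [phi]; hence the
   induction over all phases. *)
have intA x : x = 0 \/ x = 2 ->
    \int[P]_(t in digits s b `&` A x) cos (theta * S n.+1 t + phi)
    = 2^-1 ^+ (size s).+1 *
      (C n * cos (theta * c n + (phi + theta * (x / 3 ^+ n.+1)))).
  move=> hx; rewrite -(IHn (n :: s) (bx x)); last first.
  - by move=> k; rewrite inE => /predU1P[->//|/hs/ltnW].
  - by move=> k; rewrite /bx; case: ifP.
  - by rewrite /= ns.
  rewrite -DA; apply: eq_Rintegral => t; rewrite inE => -[_ /= at_x].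
  have -> : S n.+1 t = S n t + x / 3 ^+ n.+1 by rewrite -at_x /S big_ord_recr.
  by congr cos; ring.
have mA x : measurable (digits s b `&` A x).
  by apply: measurableI; [exact: measurable_digits | exact: measurable_digit].
have splitD : \int[P]_(t in digits s b) cos (theta * S n.+1 t + phi)
    = \int[P]_(t in (digits s b `&` A 0) `|` (digits s b `&` A 2))
        cos (theta * S n.+1 t + phi).
  (* The digit avoids both 0 and 2 only on a null set, which is removed here. *)
  rewrite -setIUr -[A 0 `|` A 2]setCK -setDE /Rintegral.
  rewrite -(@negligible_integral _ _ _ _ (digits s b)) //; last exact: digit_ae.
  - by apply: measurableC; apply: measurableU; exact: measurable_digit.
  - exact: measurable_digits.
  - apply: integrable_cos; first exact: measurable_digits.
    exact: measurable_cosS.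
rewrite splitD Rintegral_setU //; last 2 first.
- by apply: integrable_cos; [exact: measurableU | exact: measurable_cosS].
- apply/disj_setPS => t [[_ /= t0] [_ /= t2]].
  have /eqP := etrans (esym t0) t2; by rewrite eq_sym pnatr_eq0.
rewrite !intA; [|by right|by left].
have -> : C n.+1 = C n * cos (theta / 3 ^+ n.+1) by rewrite /C big_nat_recr.
have -> : c n.+1 = c n + 3 ^- n.+1 by rewrite /c big_nat_recr.
set y := theta * c n + phi; set z := theta / 3 ^+ n.+1.
have -> : theta * c n + (phi + theta * (0 / 3 ^+ n.+1)) = (y + z) - z.
  by rewrite /y; ring.
have -> : theta * c n + (phi + theta * (2 / 3 ^+ n.+1)) = (y + z) + z.
  by rewrite /y /z; ring.
have -> : theta * (c n + 3 ^- n.+1) + phi = y + z by rewrite /y /z; ring.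
(* cos (w - z) + cos (w + z) = 2 cos w cos z; the 2 absorbs the extra factor 1/2 from fixing one
   more digit. *)
by move: (y + z) => w; rewrite cosB cosD exprS; field.
Qed.

Lemma cvg_Rintegral_cos (X : {RV P >-> R}) phi :
  {ae P, forall t, S n t @[n --> \oo] --> X t} ->
  (C n * cos (theta * c n + phi)) @[n --> \oo] -->
  \int[P]_t cos (theta * X t + phi).
Proof.
move=> SX.
have mX D : measurable_fun D (fun t => cos (theta * X t + phi)).
  apply: measurable_funTS; apply: (measurableT_comp (f := @cos R)).
    by apply: continuous_measurable_fun; exact: continuous_cos.
  by apply: measurable_funD => //; apply: measurable_funM.
have -> : (fun n => C n * cos (theta * c n + phi)) =
    (fun n => \int[P]_t cos (theta * S n t + phi)).
  (* Conditioning on the empty list of digits is integrating over the whole space. *)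
  apply/funext => n; have := @Rintegral_cosS n [::] (fun=> 0) phi isT.
  rewrite /digits set_nil bigcap_set0 mul1r => -> //; by left.
have iX : P.-integrable setT (EFin \o (fun t => cos (theta * X t + phi))).
  exact: integrable_cos.
have [] := @dominated_convergence _ _ _ P setT measurableT
  (fun n => EFin \o (fun t => cos (theta * S n t + phi)))
  (EFin \o (fun t => cos (theta * X t + phi))) (cst 1%E).
- by move=> n; apply/measurable_EFinP; exact: measurable_cosS.
- exact/measurable_EFinP.
- apply: filterS SX => t St _ /=.
  apply: cvg_EFin; first by near=> n.
  apply: (@continuous_cvg _ _ _ _ _ _ (@cos R)); first exact: continuous_cos.
  by apply: cvgD; [exact: cvgMr | exact: cvg_cst].
- exact: finite_measure_integrable_cst.
- by apply: aeW => t n _ /=; rewrite lee_fin cos_max.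
move=> _ _ h; apply: fine_cvg; rewrite fineK //.
exact: integrable_fin_num.
Unshelve. all: by end_near.
Qed.

(** The sine is the cosine with phase -pi/2, so one limit formula serves both integrals. Before the
    limit the sum of squares is exactly [C n ^+ 2], which the product of [N] factors dominates once
    n >= N. *)
Lemma sum_sqr_Rintegral_cos (X : {RV P >-> R}) N :
  {ae P, forall t, S n t @[n --> \oo] --> X t} ->
  (\int[P]_t cos (theta * X t)) ^+ 2 + (\int[P]_t sin (theta * X t)) ^+ 2
  <= (\prod_(0 <= k < N) `|cos (theta / 3 ^+ k.+1)|) ^+ 2.
Proof.
move=> SX.
have -> : \int[P]_t sin (theta * X t)
        = \int[P]_t cos (theta * X t + - (pi / 2)).
  by apply: eq_Rintegral => t _; rewrite cosBpihalf.
have -> : \int[P]_t cos (theta * X t) = \int[P]_t cos (theta * X t + 0).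
  by apply: eq_Rintegral => t _; rewrite addr0.
have hc := @cvg_Rintegral_cos X 0 SX.
have hs := @cvg_Rintegral_cos X (- (pi / 2)) SX.
apply: (cvgr_to_le (cvgD (cvgM hc hc) (cvgM hs hs))).
exists N => // n /= leNn.
rewrite [leLHS](_ : _ = (C n * cos (theta * c n + 0)) ^+ 2
                      + (C n * cos (theta * c n - pi / 2)) ^+ 2) //.
rewrite addr0 cosBpihalf !exprMn -mulrDr cos2Dsin2 mulr1.
have -> : C n ^+ 2 = (\prod_(0 <= k < n) `|cos (theta / 3 ^+ k.+1)|) ^+ 2.
  by rewrite -normr_prod real_normK // num_real.
rewrite lerXn2r ?nnegrE ?prodr_ge0 //.
rewrite (@big_cat_nat _ _ _ N) //= ler_piMr ?prodr_ge0 //.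
by apply: prodr_ile1 => k _; rewrite normr_ge0 cos_max.
Qed.

End FourierBound.

Lemma Rintegral_distribution (R : realType) (mu : probability R R)
    (d : measure_display) (T : measurableType d) (P : probability T R)
    (X : {RV P >-> R}) (f : R -> R) :
  (forall A : set R, measurable A -> mu A = distribution P X A) ->
  continuous f -> (forall x, `|f x| <= 1) ->
  \int[mu]_x f x = \int[P]_t f (X t).
Proof.
move=> muX cf f1; have mf := continuous_measurable_fun cf.
rewrite /Rintegral; congr fine.
rewrite (eq_measure_integral (distribution P X)); last first.
  by move=> A mA _; exact: muX.
rewrite integral_distribution //; first exact/measurable_EFinP.
apply: (@measurable_bounded_integrable _ _ _ P (f \o X)) => //.
- by rewrite (le_lt_trans (probability_le1 P measurableT)) // ltry.
- exact: measurableT_comp.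
- by exists 1; split => // y y1 t _ /=; rewrite (le_trans (f1 _)) // ltW.
Qed.

Lemma normc_fourier_le (R : realType) (mu : probability R R) (q : int) N :
  cantor_measure mu -> Normc.normc (fourier mu q) <= cosprod R N q.
Proof.
case=> d [T [P [a [X [ai au SX muX]]]]].
pose theta : R := 2 * pi * q%:~R.
have ctheta : continuous (fun x : R => theta * x).
  by move=> x; apply: cvgMr; exact: cvg_id.
rewrite /fourier /Cintegral /Normc.normc /=.
rewrite (Rintegral_distribution muX); last 2 first.
- by move=> x; apply: continuous_comp; [exact: ctheta|exact: continuous_cos].
- by move=> x; exact: cos_max.
rewrite (Rintegral_distribution muX); last 2 first.
- by move=> x; apply: continuous_comp; [exact: ctheta|exact: continuous_sin].
- by move=> x; exact: sin_max.
rewrite -(ger0_norm (cosprod_ge0 R N q)) -sqrtr_sqr ler_wsqrtr //.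
exact: (sum_sqr_Rintegral_cos theta ai au N SX).
Qed.

(** * From blocks to windows, and the final estimate *)

Section Sums.
Variable R : realType.

Lemma dvdz3_mul_exp2 (u : int) n : (3 %| u * 2 ^+ n)%Z = (3 %| u)%Z.
Proof. by rewrite Gauss_dvdzl //; exact: coprimezXr. Qed.

(** Starting a block at [s] replaces [u] by u 2^s, which is still prime to 3. *)
Lemma sum_cosprod_blocks k (u c : int) s m : ~~ (3 %| u)%Z ->
  \sum_(s <= n < m * (2 * 3 ^ k) + s) cosprod R k.+1 (u * 2 ^+ n + c)
  <= m%:R * 2 ^+ k.+1.
Proof.
move=> u3; elim: m s => [|m IHm] s; first by rewrite big_geq // mul0r.
set L := (2 * 3 ^ k)%N in IHm *.
rewrite (@big_cat_nat _ _ _ (L + s)) ?leq_addl //=; last first.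
  by rewrite leq_add2r mulSn leq_addr.
rewrite -[m.+1]add1n natrD mulrDl mul1r lerD //; last first.
  by have -> : ((1 + m) * L + s = m * L + (L + s))%N by lia.
rewrite -{1}[s]add0n big_addn addnK.
under eq_bigr do rewrite addnC exprD mulrA.
by apply: sum_cosprod_block; rewrite dvdz3_mul_exp2.
Qed.

Lemma dvdz_exp3_nu3 (q : int) n : q != 0 -> (3 ^+ n %| q)%Z = (n <= nu3 q)%N.
Proof.
by move=> q0; rewrite dvdzE abszX /nu3 pfactor_dvdn // absz_gt0.
Qed.

(** Here [w] stands for the power of 2 in the other variable. As 3^e divides both [u] and [v], it
    can be factored out of the frequency, leaving a coefficient [u'] prime to 3. *)
Lemma sum_fourier_le (mu : probability R R) (u v w : int) k H M :
  cantor_measure mu -> u != 0 -> v != 0 -> (nu3 u <= nu3 v)%N ->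
  (H <= 5 * (2 * 3 ^ k))%N ->
  \sum_(M.+1 <= n < (M + H).+1) Normc.normc (fourier mu (u * 2 ^+ n + v * w))
  <= 5 * 2 ^+ k.+1.
Proof.
move=> hmu u0 v0 uv hH; set e := nu3 u.
have /dvdzP [u' uE] : (3 ^+ e %| u)%Z by rewrite dvdz_exp3_nu3.
have /dvdzP [v' vE] : (3 ^+ e %| v)%Z by rewrite dvdz_exp3_nu3.
have u'3 : ~~ (3 %| u')%Z.
  apply/negP => /dvdzP [t tE].
  have : (3 ^+ e.+1 %| u)%Z by rewrite uE tE exprS -mulrA dvdz_mull.
  by rewrite dvdz_exp3_nu3 // ltnn.
apply: le_trans (sum_cosprod_blocks k (v' * w) M.+1 5 u'3).
(* The window is enlarged to five full blocks; the added terms are nonnegative. *)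
rewrite (@big_cat_nat _ _ _ (M + H).+1 _ (5 * (2 * 3 ^ k) + M.+1)) /=;
  last 2 first.
- by rewrite ltnS leq_addr.
- by rewrite addnS ltnS addnC leq_add2r.
rewrite -[leLHS]addr0 lerD ?sumr_ge0 //; last by move=> n _; exact: cosprod_ge0.
(* Truncating at [e + k.+1] leaves [k.+1] factors after 3^e is removed. *)
apply: ler_sum => n _; apply: le_trans (normc_fourier_le _ (e + k.+1) hmu) _.
have -> : u * 2 ^+ n + v * w = 3 ^+ e * (u' * 2 ^+ n + v' * w).
  by rewrite uE vE; ring.
exact: cosprod_mul3.
Qed.

Lemma powR_3_cantor_dim : 3 `^ cantor_dim R = 2.
Proof.
have ln3 : ln (3 : R) != 0 by rewrite gt_eqF // ln_gt0 // ltr1n.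
by rewrite /powR pnatr_eq0 /= /cantor_dim divfK // lnK // posrE.
Qed.

Lemma cantor_dim_ge0 : 0 <= cantor_dim R.
Proof. by rewrite divr_ge0 // ln_ge0 // ler1n. Qed.

Lemma cantor_dim_le1 : cantor_dim R <= 1.
Proof.
by rewrite ler_pdivrMr ?ln_gt0 ?ltr1n // mul1r ler_ln ?posrE // ler_nat.
Qed.

(** Since 2 = 3^gamma, the left side is (3^K)^gamma. *)
Lemma exp2_le_powR_cantor_dim (H K : nat) : (3 ^ K <= H)%N ->
  2 ^+ K <= H%:R `^ cantor_dim R.
Proof.
move=> hK; rewrite -powR_3_cantor_dim -powR_mulrn ?powR_ge0 // -powRrM mulrC.
rewrite powRrM powR_mulrn // ge0_ler_powR ?nnegrE ?cantor_dim_ge0 ?exprn_ge0 //.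
by rewrite -natrX ler_nat.
Qed.

End Sums.

Theorem lemma8 (R : realType) :
  let gamma : R := cantor_dim R in
  let beta : R := 1 - gamma in
  exists A0 : R, 0 < A0 /\
  forall mu : probability R R, cantor_measure mu ->
  forall H K : nat, (3 <= H)%N -> (3 ^ K <= H < 3 ^ K.+1)%N ->
  forall (M : nat) (u v : int), u != 0 -> v != 0 ->
  \sum_(M.+1 <= n < (M + H).+1) \sum_(M.+1 <= m < (M + H).+1)
     Normc.normc (fourier mu (u * 2 ^+ n + v * 2 ^+ m))
  <= A0 * H%:R `^ (1 + gamma)
        * 3 `^ (beta * (minn (minn (nu3 u) (nu3 v)) K)%:R).
Proof.
(* The constant 5 is the number of blocks covering a window. K = 0 would force H < 3, so K = k +
   1. *)
move=> gamma beta; exists 5; split=> // mu hmu H [|k] H3 /andP[lbH ubH].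
  by move: (leq_trans ubH H3); rewrite ltnn.
move=> M u v u0 v0.
(* H < 3^(k+2) = 9 * 3^k, while five blocks have length 10 * 3^k. *)
have hH : (H <= 5 * (2 * 3 ^ k))%N.
  by rewrite (leq_trans (ltnW ubH)) // !expnS !mulnA leq_mul2r orbT.
have sum_const : \sum_(M.+1 <= n < (M + H).+1) (5 * 2 ^+ k.+1 : R)
    = H%:R * (5 * 2 ^+ k.+1).
  by rewrite sumr_const_nat subSS addKn [RHS]mulr_natl.
apply: (@le_trans _ _ (H%:R * (5 * 2 ^+ k.+1))).
  (* The inner sum runs over the exponent attached to the coefficient of smaller valuation. *)
  rewrite -sum_const; case: (leqP (nu3 u) (nu3 v)) => [uv|/ltnW vu].
    rewrite exchange_big_nat /=; apply: ler_sum => m _.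
    exact: sum_fourier_le.
  apply: ler_sum => n _; under eq_bigr do rewrite addrC.
  exact: sum_fourier_le.
rewrite powRD; last by rewrite pnatr_eq0 -lt0n (leq_trans _ H3) // implybT.
rewrite powRr1 //.
apply: (@le_trans _ _ (5 * (H%:R * H%:R `^ gamma))).
  by rewrite mulrCA ler_pM2l // ler_wpM2l // exp2_le_powR_cantor_dim.
(* The power of 3 is at least 1, its exponent being nonnegative because gamma <= 1. *)
rewrite ler_peMr ?mulr_ge0 ?powR_ge0 // -[leLHS](powRr0 3) ler_powR ?ler1n //.
by rewrite mulr_ge0 // subr_ge0 cantor_dim_le1.
Qed.
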